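(* Let $K$ be either a finite field $\mathbb{F}_q$ or $\mathbb{C}$. Let $V$ be a vector space over $K$; if $K$ is finite, $V$ may have finite or countably infinite dimension, whereas if $K=\mathbb{C}$, $V$ is required to be finite-dimensional. Let $D,d,l,r\in\mathbb{N}$ with $l\geq 2$ and let $H\leq \mathrm{GL}(V)$ be a linearly $D$-transitive group. Let $$w=x_{\iota(1)}^{\varepsilon(1)}c_1x_{\iota(2)}^{\varepsilon(2)}\cdots c_{l-1}x_{\iota(l)}^{\varepsilon(l)}\in \mathrm{GL}(V)\ast\mathbf{F}_r$$ be reduced (with respect to $H$) of length $l$. Let $\{u_1,\ldots,u_d\}$ and $\{w_1,\ldots,w_d\}$ be $d$-element sets of linearly independent vectors of $V$. If $\iota(1)=\iota(l)$ and $\varepsilon(1)=-\varepsilon(l)$, assume in addition that the linear spans of $\{u_1,\ldots,u_d\}$ and $\{w_1,\ldots,w_d\}$ intersect trivially. If $$d\leq \frac1l\cdot\min\{|w|_{\rm crit}-1,\,D\},$$ then there exist $h_1,\ldots,h_r\in H$ such that $u_i.w(h_1,\ldots,h_r)=w_i$ for all $i\in\{1,\ldots,d\}$.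
   Context: $\mathbf{F}_r=\langle x_1,\ldots,x_r\rangle$ is the free group of rank $r$, and $G\ast\mathbf{F}_r$ is the free product. For $w\in G\ast\mathbf{F}_r$ and $h_1,\dots,h_r\in G$, $w(h_1,\dots,h_r)$ is the image of $w$ under the homomorphism $G\ast\mathbf{F}_r\to G$ that is the identity on $G$ and maps $x_i\mapsto h_i$. Linear maps act on vectors from the right: $v.g$ is the image of $v\in V$ under $g\in\mathrm{GL}(V)$, so $v.(gh)=(v.g).h$. Here $G=\mathrm{GL}(V)$, $c_j\in G$, $\iota(j)\in\{1,\dots,r\}$, $\varepsilon(j)\in\{\pm1\}$. The length of the word is $l$. Define subsets of $\{1,\dots,l-1\}$: $J_0(w)=\{j:\iota(j)\neq\iota(j+1)\}$, $J_+(w)=\{j:\iota(j)=\iota(j+1),\ \varepsilon(j)=\varepsilon(j+1)\}$, $J_-(w)=\{j:\iota(j)=\iota(j+1),\ \varepsilon(j)=-\varepsilon(j+1)\}$. The expression is reduced (with respect to the subgroup $H\leq G$ whose elements are plugged in) if $c_j\notin \mathbf{C}_G(H)\setminus\{1\}$ for $j\in J_0(w)\cup J_+(w)$ and $c_j\notin\mathbf{C}_G(H)$ for $j\in J_-(w)$, where $\mathbf{C}_G(H)$ is the centralizer of $H$ in $G$. The projective rank seminorm on $\mathrm{GL}(V)$ is $|g|=\min_{\lambda\in K^\times}\mathrm{rk}(g-\lambda 1_V)\in\mathbb{N}\cup\{\infty\}$, with pseudometric $\mathrm{dist}(g,h)=|g^{-1}h|$. The critical length is $|w|_{\rm crit}=\min\left(\{\mathrm{diam}(\mathrm{GL}(V))\}\cup\{|c_j|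 : j\in J_-(w)\}\right)$, the diameter being taken in this pseudometric. A group $H\leq\mathrm{GL}(V)$ is linearly $k$-transitive, where $k\le\dim V$, if for all $k$-element sets of linearly independent vectors $\{u_1,\ldots,u_k\}$ and $\{w_1,\ldots,w_k\}$ of $V$ there is $h\in H$ with $u_i.h=w_i$ for all $i\in\{1,\ldots,k\}$. *)

(* Defs.v *)
From HB Require Import structures.
From mathcomp Require Import all_boot all_order all_algebra.
From mathcomp Require Import all_classical all_reals ereal.
From mathcomp Require Import complex.
Set Implicit Arguments.
Unset Strict Implicit.
Unset Printing Implicit Defensive.

Import Order.TTheory GRing.Theory Num.Theory.

Local Open Scope classical_set_scope.
Local Open Scope ring_scope.

Section LinearIndependence.
Variables (K : fieldType) (V : lmodType K).

Definition lin_free (n : nat) (u : 'I_n -> V) : Prop :=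
  forall a : 'I_n -> K, \sum_(i < n) a i *: u i = 0 -> forall i, a i = 0.

Definition lin_span (n : nat) (u : 'I_n -> V) : set V :=
  [set v | exists a : 'I_n -> K, v = \sum_(i < n) a i *: u i].

Definition is_basis (B : set V) : Prop :=
  (forall n (u : 'I_n -> V), injective u -> (forall i, B (u i)) -> lin_free u)
  /\ (forall v, exists n (u : 'I_n -> V),
        (forall i, B (u i)) /\ lin_span u v).

Definition finite_dim : Prop := exists B, is_basis B /\ finite_set B.

Definition countable_dim : Prop := exists B, is_basis B /\ countable B.

(* The dimension of a subspace W, with values in N u {+oo}. *)
Definition edim (R : realType) (W : set V) : \bar R :=
  ereal_sup [set n%:R%:E | n in
    [set n : nat | exists u : 'I_n -> V, lin_free u /\ forall i, W (u i)]].

End LinearIndependence.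

Record GL (K : fieldType) (V : lmodType K) := MkGL {
  gl_fun :> V -> V;
  gl_linear : linear gl_fun;
  gl_bij : bijective gl_fun }.

Section GLGroup.
Variables (K : fieldType) (V : lmodType K).
Implicit Types g h : GL V.

HB.instance Definition _ := gen_eqMixin (GL V).
HB.instance Definition _ := gen_choiceMixin (GL V).

Lemma gl_ext g h : g =1 h -> g = h.
Proof.
case: g h => [f fl fb] [f' fl' fb'] /= /funext eff'; subst f'.
by rewrite (Prop_irrelevance fl fl') (Prop_irrelevance fb fb').
Qed.

Lemma gl_one_linear : linear (@id V).
Proof. by []. Qed.

Definition gl_one : GL V :=
  MkGL gl_one_linear (Bijective (fun=> erefl) (fun=> erefl)).

Lemma gl_mul_linear g h : linear (h \o g).
Proof. by move=> a u v; rewrite /= !gl_linear. Qed.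

(* Maps act from the right: v.(gh) = (v.g).h. *)
Definition gl_mul g h : GL V :=
  MkGL (@gl_mul_linear g h) (bij_comp (gl_bij h) (gl_bij g)).

Lemma gl_inv_exists g : exists g' : GL V, cancel g g' /\ cancel g' g.
Proof.
have [f gK fK] := gl_bij g.
have fl : linear f.
  by move=> a u v; apply: (can_inj gK); rewrite gl_linear !fK.
by exists (MkGL fl (Bijective fK gK)).
Qed.

Definition gl_inv g : GL V := projT1 (cid (gl_inv_exists g)).

Lemma gl_invP g : cancel g (gl_inv g) /\ cancel (gl_inv g) g.
Proof. exact: (projT2 (cid (gl_inv_exists g))). Qed.

Lemma gl_mulA : associative gl_mul.
Proof. by move=> f g h; apply: gl_ext. Qed.

Lemma gl_mul1 : left_id gl_one gl_mul.
Proof. by move=> g; apply: gl_ext. Qed.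

Lemma gl_mulr1 : right_id gl_one gl_mul.
Proof. by move=> g; apply: gl_ext. Qed.

Lemma gl_mulV : left_inverse gl_one gl_inv gl_mul.
Proof. by move=> g; apply: gl_ext => v; apply: (gl_invP g).2. Qed.

Lemma gl_mulrV : right_inverse gl_one gl_inv gl_mul.
Proof. by move=> g; apply: gl_ext => v; apply: (gl_invP g).1. Qed.

HB.instance Definition _ :=
  isGroup.Build (GL V) gl_mulA gl_mul1 gl_mulr1 gl_mulV gl_mulrV.

End GLGroup.

(* The free product G * F_r: words in the elements of G and the letters
   x_i (inr (i, false)) and x_i^-1 (inr (i, true)), modulo the congruence
   generated by the multiplication table of G and free cancellation. *)
Section FreeProduct.
Variables (G : groupType) (r : nat).

Definition fletter : Type := (G + 'I_r * bool)%type.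
HB.instance Definition _ := Choice.on fletter.

Definition fword : Type := seq fletter.
HB.instance Definition _ := Choice.on fword.

Definition gl_letter (g : G) : fletter := inl g.
Definition var_letter (i : 'I_r) (b : bool) : fletter := inr (i, b).

Inductive fcong : fword -> fword -> Prop :=
| FRefl s : fcong s s
| FSym s t : fcong s t -> fcong t s
| FTrans s t u : fcong s t -> fcong t u -> fcong s u
| FCat s s' t t' : fcong s s' -> fcong t t' -> fcong (s ++ t) (s' ++ t')
| FOne : fcong [:: gl_letter 1%g] [::]
| FMul g h : fcong [:: gl_letter g; gl_letter h] [:: gl_letter (g * h)%g]
| FVar i b : fcong [:: var_letter i b; var_letter i (~~ b)] [::].

Definition fcongb : rel fword := fun s t => `[< fcong s t >].

Lemma fcongb_equiv : equiv_class_of fcongb.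
Proof.
split=> [s|s t|t s u].
- by apply/asboolP; exact: FRefl.
- by apply/asboolP/asboolP; exact: FSym.
- by move=> /asboolP st /asboolP tu; apply/asboolP; exact: FTrans st tu.
Qed.

Canonical fcongb_equivRel := EquivRelPack fcongb_equiv.
Canonical fcongb_encModRel := defaultEncModRel fcongb.

Definition freeprod := {eq_quot fcongb}%qT.

HB.instance Definition _ := Choice.on freeprod.

Definition fpi (s : fword) : freeprod := (\pi_({eq_quot fcongb}) s)%qT.
Definition frepr (w : freeprod) : fword := repr w.

Lemma freprK : cancel frepr fpi.
Proof. exact: reprK. Qed.

Lemma fpiP s t : fpi s = fpi t <-> fcong s t.
Proof.
by split=> [/eqmodP/asboolP //|st]; apply/eqmodP/asboolP.
Qed.

Lemma frepr_fpi s : fcong (frepr (fpi s)) s.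
Proof. by apply/fpiP; rewrite freprK. Qed.

Definition finv_letter (a : fletter) : fletter :=
  match a with
  | inl g => gl_letter g^-1%g
  | inr (i, b) => var_letter i (~~ b)
  end.

Definition finv_word (s : fword) : fword := rev (map finv_letter s).

Definition fmul (v w : freeprod) : freeprod := fpi (frepr v ++ frepr w).
Definition fone : freeprod := fpi [::].
Definition finv (w : freeprod) : freeprod := fpi (finv_word (frepr w)).

Lemma fmul_pi s t : fmul (fpi s) (fpi t) = fpi (s ++ t).
Proof. by apply/fpiP; apply: FCat; apply: frepr_fpi. Qed.

Lemma fmulA : associative fmul.
Proof.
move=> u v w; rewrite -[u]freprK -[v]freprK -[w]freprK.
by rewrite !fmul_pi catA.
Qed.

Lemma fmul1 : left_id fone fmul.
Proof. by move=> w; rewrite -[w]freprK fmul_pi. Qed.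

Lemma fmulr1 : right_id fone fmul.
Proof. by move=> w; rewrite -[w]freprK fmul_pi cats0. Qed.

Lemma fcong_invl a : fcong [:: finv_letter a; a] [::].
Proof.
case: a => [g|[i b]] /=.
  by apply: FTrans (FMul _ _) _; rewrite mulVg; exact: FOne.
by rewrite -{2}[b]negbK; exact: FVar.
Qed.

Lemma fcong_invr a : fcong [:: a; finv_letter a] [::].
Proof.
case: a => [g|[i b]] /=; last exact: FVar.
by apply: FTrans (FMul _ _) _; rewrite mulgV; exact: FOne.
Qed.

Lemma fcong_mid s t u : fcong t [::] -> fcong (s ++ t ++ u) (s ++ u).
Proof.
move=> t0; apply: FCat (FRefl _) _.
by rewrite -{2}[u]cat0s; apply: FCat t0 (FRefl _).
Qed.

Lemma finv_wordl s : fcong (finv_word s ++ s) [::].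
Proof.
elim: s => [|a s IH]; first exact: FRefl.
rewrite /finv_word /= rev_cons cat_rcons.
apply: FTrans IH; exact: (@fcong_mid _ [:: finv_letter a; a] s (fcong_invl a)).
Qed.

Lemma finv_wordr s : fcong (s ++ finv_word s) [::].
Proof.
elim/last_ind: s => [|s a IH]; first exact: FRefl.
rewrite /finv_word map_rcons rev_rcons cat_rcons.
apply: FTrans IH.
exact: (@fcong_mid s [:: a; finv_letter a] _ (fcong_invr a)).
Qed.

Lemma fmulV : left_inverse fone finv fmul.
Proof.
by move=> w; rewrite -{2}[w]freprK fmul_pi; apply/fpiP; exact: finv_wordl.
Qed.

Lemma fmulrV : right_inverse fone finv fmul.
Proof.
by move=> w; rewrite -{1}[w]freprK fmul_pi; apply/fpiP; exact: finv_wordr.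
Qed.

HB.instance Definition _ :=
  isGroup.Build freeprod fmulA fmul1 fmulr1 fmulV fmulrV.

Definition freeprod_in (g : G) : freeprod := fpi [:: gl_letter g].
Definition freeprod_var (i : 'I_r) : freeprod := fpi [:: var_letter i false].

Lemma freeprod_inM : {morph freeprod_in : g h / (g * h)%g}.
Proof. by move=> g h; rewrite [RHS]fmul_pi; apply/fpiP/FSym/FMul. Qed.

Lemma freeprod_varV i : (freeprod_var i)^-1%g = fpi [:: var_letter i true].
Proof.
apply: (@mulgI _ (freeprod_var i)); rewrite mulgV [RHS]fmul_pi.
by apply/fpiP/FSym/FVar.
Qed.

Lemma freeprod_inF : {morph freeprod_in : g h / (g / h)%g}.
Proof.
by move=> g h; apply: (@mulIg _ (freeprod_in h)); rewrite -freeprod_inM !mulgVK.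
Qed.

HB.instance Definition _ :=
  isGroupMorphism.Build G freeprod freeprod_in freeprod_inF.

Section Eval.
Variable h : 'I_r -> G.

Definition letter_eval (a : fletter) : G :=
  match a with
  | inl g => g
  | inr (i, b) => if b then (h i)^-1%g else h i
  end.

Definition word_eval (s : fword) : G := (\prod_(a <- s) letter_eval a)%g.

(* w(h_1, ..., h_r) *)
Definition freeprod_eval (w : freeprod) : G := word_eval (frepr w).

Lemma word_eval_cong s t : fcong s t -> word_eval s = word_eval t.
Proof.
rewrite /word_eval; elim=> {s t}
  [//|s t _ ->//|s t u _ -> _ ->//|s s' t t' _ es _ et||g g'|i b].
- by rewrite !big_cat es et.
- by rewrite big_seq1 big_nil.
- by rewrite !big_cons !big_nil !mulg1.
- by rewrite !big_cons !big_nil /= mulg1; case: b; rewrite ?mulVg ?mulgV.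
Qed.

Lemma freeprod_eval_pi s : freeprod_eval (fpi s) = word_eval s.
Proof. exact: word_eval_cong (frepr_fpi s). Qed.

Lemma freeprod_evalM : {morph freeprod_eval : v w / (v * w)%g}.
Proof.
move=> v w; rewrite -[v]freprK -[w]freprK [(_ * _)%g]fmul_pi.
by rewrite !freeprod_eval_pi /word_eval big_cat.
Qed.

Lemma freeprod_evalF : {morph freeprod_eval : v w / (v / w)%g}.
Proof.
move=> v w; apply: (@mulIg _ (freeprod_eval w)).
by rewrite -freeprod_evalM !mulgVK.
Qed.

HB.instance Definition _ :=
  isGroupMorphism.Build freeprod G freeprod_eval freeprod_evalF.

Lemma freeprod_eval_in g : freeprod_eval (freeprod_in g) = g.
Proof. by rewrite freeprod_eval_pi /word_eval big_seq1. Qed.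

Lemma freeprod_eval_var i : freeprod_eval (freeprod_var i) = h i.
Proof. by rewrite freeprod_eval_pi /word_eval big_seq1. Qed.

Lemma freeprod_eval_uniq (f : freeprod -> G) :
  {morph f : v w / (v * w)%g} -> (forall g, f (freeprod_in g) = g) ->
  (forall i, f (freeprod_var i) = h i) -> f = freeprod_eval.
Proof.
move=> fM fin fvar.
have f1 : f 1%g = 1%g by apply: (@mulgI _ (f 1%g)); rewrite -fM !mulg1.
apply/funext => w; rewrite -[w]freprK.
rewrite freeprod_eval_pi; elim: (frepr w) => [|a s IH].
  by rewrite /word_eval big_nil.
rewrite -cat1s -fmul_pi fM IH /word_eval big_cat big_seq1; congr (_ * _)%g.
case: a => [g|[i []]] /=; [exact: fin | | exact: fvar].
by apply: (@mulgI _ (h i)); rewrite mulgV -{1}fvar -freeprod_varV -fM mulgV.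
Qed.

End Eval.

End FreeProduct.

Section Words.
Variables (G : groupType) (r : nat).

(* Words are indexed from 1, as in x_{iota 1}^{eps 1} c_1 x_{iota 2}^{eps 2}
   ... c_{l-1} x_{iota l}^{eps l}: only iota j, eps j with 1 <= j <= l and
   c j with 1 <= j < l matter. The exponent at j is (-1) ^ (eps j). *)
Variables (l : nat) (iota : nat -> 'I_r) (eps : nat -> bool) (c : nat -> G).

Definition syllable (j : nat) : freeprod G r :=
  if eps j then (freeprod_var G (iota j))^-1%g else freeprod_var G (iota j).

Definition word_expr : freeprod G r :=
  ((\prod_(1 <= j < l) (syllable j * freeprod_in r (c j))) * syllable l)%g.

Definition J_zero : set nat :=
  [set j | (1 <= j < l)%N /\ iota j <> iota j.+1].

Definition J_plus : set nat :=
  [set j | [/\ (1 <= j < l)%N, iota j = iota j.+1 & eps j = eps j.+1]].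

Definition J_minus : set nat :=
  [set j | [/\ (1 <= j < l)%N, iota j = iota j.+1 & eps j <> eps j.+1]].

Definition centralizer (H : {pred G}) : set G :=
  [set g | forall h, h \in H -> commute g h].

Definition reduced (H : {pred G}) : Prop :=
  (forall j, (J_zero `|` J_plus) j -> ~ (centralizer H `\ 1%g) (c j)) /\
  (forall j, J_minus j -> ~ centralizer H (c j)).

End Words.

Section ProjectiveRank.
Variables (R : realType) (K : fieldType) (V : lmodType K).

Definition erank (f : V -> V) : \bar R := edim R (range f).

Definition proj_rank (g : GL V) : \bar R :=
  ereal_inf [set erank (fun v => g v - a *: v) | a in [set a : K | a != 0]].

Definition proj_dist (g h : GL V) : \bar R := proj_rank (g^-1 * h)%g.

Definition proj_diam : \bar R :=
  ereal_sup [set proj_dist gh.1 gh.2 | gh in [set: GL V * GL V]].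

Definition crit_length (r l : nat) (iota : nat -> 'I_r) (eps : nat -> bool)
    (c : nat -> GL V) : \bar R :=
  ereal_inf ([set proj_diam] `|`
    [set proj_rank (c j) | j in J_minus l iota eps]).

Definition lin_transitive (k : nat) (H : {pred GL V}) : Prop :=
  (k%:R%:E <= edim R [set: V])%E /\
  forall u w : 'I_k -> V, lin_free u -> lin_free w ->
    exists2 h : GL V, h \in H & forall i, h (u i) = w i.

End ProjectiveRank.

(* Main.v *)
(* Follow the vectors u_i through the word: before and after each letter
   x_iota(j)^eps(j) the trajectory of u_i passes through a vector, and the
   vector before letter j+1 is the image under c_j of the one after letter j.
   Each variable x_k receives a set of prescribed values; if its prescribed
   arguments are independent, and its prescribed values too, then
   D-transitivity provides h_k, as at most l d <= D vectors are prescribed.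
   The intermediate vectors y (and y.c_j) are chosen greedily, one at a time.
   For j in J_0 and J_+ the vectors y and y.c_j enter two different families,
   so that y must avoid two proper subspaces.  For j in J_- both enter the same
   family, with span A, so that y and y.c_j must be independent modulo A.  If
   no such y existed, the maps v -> v + A and v -> v.c_j + A would be locally
   linearly dependent, hence proportional, so that c_j - a would have range
   inside A for some a, against |c_j| > l d. *)

Require Import Defs.
From HB Require Import structures.
From mathcomp Require Import all_boot all_order all_algebra.
From mathcomp Require Import all_classical all_reals ereal.
From mathcomp Require Import complex.
Set Implicit Arguments.
Unset Strict Implicit.
Unset Printing Implicit Defensive.

Import Order.TTheory GRing.Theory Num.Theory.

Local Open Scope classical_set_scope.
Local Open Scope ring_scope.

(* Decides equality of sums in a zmodType, up to reordering and cancellation of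
   opposite terms; scalar multiples are treated as atoms. *)
Ltac zmod_cancel := apply/eqP; rewrite -subr_eq0; apply/eqP;
  rewrite -[LHS]addr0 ?(opprD, opprK, oppr0) -!addrA;
  repeat (rewrite ?add0r ?(addNKr, addKr);
   match goal with
   | |- (?t + ?r = 0)%R => 
      match t with
      | (- ?t')%R => repeat rewrite (addrCA _ t'); rewrite addNKr
      | _ => repeat rewrite (addrCA _ (- t)); rewrite addKr
      end
   end); rewrite ?(addr0, subrr, addNr) //.

(** * Subspaces and independence modulo a subspace *)

Section LinearAlgebra.
Variables (K : fieldType) (V : lmodType K).
Implicit Types (A B : set V) (g : V -> V).

Definition is_submod A := A 0 /\ forall a x y, A x -> A y -> A (a *: x + y).

Section Submod.
Variables (A : set V) (hA : is_submod A).

Lemma submodD x y : A x -> A y -> A (x + y).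
Proof. by move=> Ax Ay; rewrite -[x]scale1r; apply: hA.2. Qed.

Lemma submodZ a x : A x -> A (a *: x).
Proof. by move=> Ax; rewrite -[_ *: _]addr0; apply: hA.2 => //; apply: hA.1. Qed.

Lemma submodB x y : A x -> A y -> A (x - y).
Proof. by move=> Ax Ay; rewrite addrC -scaleN1r; apply: hA.2. Qed.

Lemma submodDl x y : A x -> A (x + y) -> A y.
Proof. by move=> Ax /submodB /(_ Ax); rewrite addrAC subrr add0r. Qed.

End Submod.

(** If neither [x] nor [y] works, then [x] lies in [B] and [y] in [A], so [x + y] lies in
    neither. *)
Lemma avoid_two_submods A B : is_submod A -> is_submod B ->
  (exists x, ~ A x) -> (exists x, ~ B x) -> exists x, ~ A x /\ ~ B x.
Proof.
move=> hA hB [x nAx] [y nBy].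
have [Bx|nBx] := pselect (B x); last by exists x.
have [Ay|nAy] := pselect (A y); last by exists y.
exists (x + y); split; last by move=> /(submodDl hB Bx).
by rewrite addrC => /(submodDl hA Ay).
Qed.

(** Independence of the classes of [x] and [y] in V / A, phrased without the quotient. *)
Definition free_pair_mod A x y :=
  forall a b, A (a *: x + b *: y) -> a = 0 /\ b = 0.

Lemma dependent_pair_mod A x y : ~ free_pair_mod A x y ->
  is_submod A -> A x \/ exists a, A (y - a *: x).
Proof.
move=> + hA; have [Ax _|nAx nf] := pselect (A x); first by left.
right; apply: contrapT => nex; apply: nf => a b Aab.
have b0 : b = 0.
  apply/eqP/negPn/negP => b0; apply: nex; exists (- (b^-1 * a)).
  move/(submodZ hA b^-1): Aab.
  by rewrite scalerDr !scalerA mulVf // scale1r scaleNr opprK addrC.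
split=> //; apply/eqP/negPn/negP => a0; apply: nAx.
move/(submodZ hA a^-1): Aab.
by rewrite b0 scale0r addr0 scalerA mulVf // scale1r.
Qed.

(** Modulo [A], [f] takes the same value at [x], [x + y1] and [x + y2]. If [f x] is a nonzero
    multiple of [x], then [x] is tied to [y1] and to [y2], which forces [x], hence [f x], into
    [A]. *)
Lemma locally_scalar_mod A f (hA : is_submod A) y1 y2 :
  {morph f : x y / x + y} -> free_pair_mod A y1 y2 -> A (f y1) -> A (f y2) ->
  (forall x, A x \/ exists a, A (f x - a *: x)) -> forall x, A (f x).
Proof.
move=> fD hy f1 f2 dep x.
have Aeq u v : A u -> u = v -> A v by move=> Au <-.
have shift y : A (f y) -> A (x + y) \/ exists a, A (f x - a *: (x + y)).
  move=> Ay; have [?|[a Ha]] := dep (x + y); [by left|right; exists a].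
  by apply: (submodDl hA Ay); rewrite addrA -fD [y + x]addrC.
have [Ax|[b Hb]] := dep x.
  (* [f] need not preserve [A]: for [x] in [A], the class of [f x] is a multiple of those of [y1]
     and [y2], hence zero. *)
  have [Axy|[a1 H1]] := shift _ f1.
    have [] := hy 1 0; last by move/eqP; rewrite oner_eq0.
    by rewrite scale1r scale0r addr0; exact: submodDl Axy.
  have [Axy|[a2 H2]] := shift _ f2.
    have [] := hy 0 1; last by move=> _ /eqP; rewrite oner_eq0.
    by rewrite scale1r scale0r add0r; exact: submodDl Axy.
  have [|a10 _] := hy a1 (- a2).
    apply: (@Aeq ((f x - a2 *: (x + y2)) - (f x - a1 *: (x + y1))
                   + (a2 - a1) *: x)).
      by apply: submodD => //; [apply: submodB|apply: submodZ].
    rewrite !scalerDr scalerBl scaleNr. zmod_cancel.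
  by move: H1; rewrite a10 scale0r subr0.
have comb c d z t : A z -> A t -> A (c *: z - d *: t).
  by move=> Az At; apply: submodB => //; apply: submodZ.
have [b0|/eqP b0] := pselect (b = 0); first by move: Hb; rewrite b0 scale0r subr0.
(* With [b] nonzero, [x] satisfies a nontrivial relation modulo [A] with every [y] that [f] maps
   into [A]. *)
have part y : A (f y) -> exists c e, (c != 0 \/ e != 0) /\ A (c *: x + e *: y).
  move=> Ay; have [Axy|[a Ha]] := shift _ Ay.
    by exists 1, 1; rewrite oner_neq0 !scale1r; split => //; left.
  have [ab|/eqP ab] := pselect (a = b).
    exists 0, b; split; first by right.
    apply: (Aeq _ _ (submodB hA Hb Ha)); rewrite ab scale0r !scalerDr.
    zmod_cancel.
  exists (a - b), a; split; first by left; rewrite subr_eq0.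
  apply: (Aeq _ _ (submodB hA Hb Ha)); rewrite scalerBl !scalerDr.
  zmod_cancel.
have [c1 [e1 [n1 H1]]] := part _ f1.
have [c2 [e2 [n2 H2]]] := part _ f2.
(* Eliminating [x] leaves a relation between [y1] and [y2]. *)
have [|/eqP h1] := hy (c2 * e1) (- (c1 * e2)).
  apply: (Aeq _ _ (comb c2 c1 _ _ H1 H2)).
  by rewrite !scalerDr !scalerA [c1 * c2]mulrC scaleNr; zmod_cancel.
move=> /eqP; rewrite oppr_eq0 mulf_eq0 => h2.
have c1n0 : c1 != 0.
  case: n1 => // e1n0; apply/eqP => c10.
  have [] := hy e1 0; last by move=> e10; rewrite e10 eqxx in e1n0.
  by move: H1; rewrite c10 !scale0r add0r addr0.
have e20 : e2 = 0 by apply/eqP; move: h2; rewrite (negbTE c1n0).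
have c2n0 : c2 != 0 by case: n2 => //; rewrite e20 eqxx.
have Ax : A x.
  move/(submodZ hA c2^-1): H2.
  by rewrite e20 scale0r addr0 scalerA mulVf // scale1r.
by rewrite -[f x](subrK (b *: x)); apply: submodD => //; apply: submodZ.
Qed.

(* Locally linearly dependent maps into V / A are proportional as soon as one
   of them (here the quotient map) has rank at least 2, over any field. *)
Lemma exists_free_pair_mod A g : is_submod A -> linear g ->
  (exists y1 y2, free_pair_mod A y1 y2) ->
  (forall a, exists x, ~ A (g x - a *: x)) ->
  exists x, free_pair_mod A x (g x).
Proof.
move=> hA gl [y1 [y2 hy]] hg; apply: contrapT => nex.
have dep x : A x \/ exists a, A (g x - a *: x).
  by apply: dependent_pair_mod => // hx; apply: nex; exists x.
have gD x y : g (x + y) = g x + g y by rewrite -{1}[x]scale1r gl scale1r.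
have Aeq u v : A u -> u = v -> A v by move=> Au <-.
have [A1|[a1 H1]] := dep y1.
  have [] := hy 1 0; last by move/eqP; rewrite oner_eq0.
  by rewrite scale1r scale0r addr0.
have [A2|[a2 H2]] := dep y2.
  have [] := hy 0 1; last by move=> _ /eqP; rewrite oner_eq0.
  by rewrite scale1r scale0r add0r.
(* Comparison at [y1 + y2] forces one common scalar, which is then subtracted from [g]. *)
have e12 : a1 = a2.
  have [A12|[b Hb]] := dep (y1 + y2).
    by have [] := hy 1 1; [rewrite !scale1r|move/eqP; rewrite oner_eq0].
  have [|/subr0_eq -> /subr0_eq -> //] := hy (a1 - b) (a2 - b).
  apply: (Aeq ((g (y1 + y2) - b *: (y1 + y2))
    - ((g y1 - a1 *: y1) + (g y2 - a2 *: y2)))).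
    by apply: submodB => //; apply: submodD.
  by rewrite gD !scalerBl scalerDr; zmod_cancel.
subst a2; have [x] := hg a1; apply.
apply: (locally_scalar_mod (f := fun x => g x - a1 *: x) hA _ hy H1 H2) => {x}.
  by move=> x y; rewrite gD scalerDr; zmod_cancel.
move=> x; have [?|[a Ha]] := dep x; [by left|right; exists (a - a1)].
by apply: Aeq Ha _; rewrite scalerBl; zmod_cancel.
Qed.

(** * Independent families over a finite type and their spans *)

Section FreeFamilies.
Variables (T : finType).
Implicit Types (F : T -> V) (P Q : pred T).

Definition free_on F P : Prop :=
  forall a : T -> K, \sum_(t | P t) a t *: F t = 0 -> forall t, P t -> a t = 0.

Definition span_on F P : set V :=
  [set v | exists a : T -> K, v = \sum_(t | P t) a t *: F t].

Lemma span_on_submod F P : is_submod (span_on F P).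
Proof.
split; first by exists (fun=> 0); rewrite big1 // => t _; rewrite scale0r.
move=> k x y [a ->] [b ->]; exists (fun t => k * a t + b t).
rewrite scaler_sumr -big_split /=; apply: eq_bigr => t _.
by rewrite scalerDl scalerA.
Qed.

Lemma eq_free_on F F' P P' : P =1 P' -> (forall t, P t -> F t = F' t) ->
  free_on F P -> free_on F' P'.
Proof.
move=> eP eF fF a a0 t Pt; apply: fF; last by rewrite eP.
by rewrite -[RHS]a0 -(eq_bigl _ _ eP); apply: eq_bigr => s Ps; rewrite eF.
Qed.

Lemma sum_predU1 (E : T -> V) P t : ~~ P t ->
  \sum_(s | (s == t) || P s) E s = E t + \sum_(s | P s) E s.
Proof.
move=> nPt; rewrite (bigD1 t) ?eqxx //=; congr (_ + _).
apply: eq_bigl => s; have [->|] := eqVneq s t; first by rewrite (negbTE nPt).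
by rewrite andbT.
Qed.

Lemma free_on_add F P t : ~~ P t -> ~ span_on F P (F t) -> free_on F P ->
  free_on F (fun s => (s == t) || P s).
Proof.
move=> nPt nF fF a; rewrite sum_predU1 // => a0.
have [at0|atn0] := eqVneq (a t) 0.
  move: a0; rewrite at0 scale0r add0r => /fF h s /orP[/eqP ->//|]; exact: h.
case: nF; exists (fun s => - ((a t)^-1 * a s)).
have -> : F t = (a t)^-1 *: (a t *: F t) by rewrite scalerA mulVf // scale1r.
move/eqP: a0; rewrite addr_eq0 => /eqP ->.
rewrite scalerN scaler_sumr -sumrN; apply: eq_bigr => s _.
by rewrite scaleNr scalerA.
Qed.

End FreeFamilies.

(** If [n] exceeded [size s], the coefficient matrix would have a nonzero left kernel vector, which
    is a relation among the [e i]. *)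
Lemma lin_free_span n (e : 'I_n -> V) (T : Type) (s : seq T) (F : T -> V) :
  lin_free e ->
  (forall i, exists a : T -> K, e i = \sum_(t <- s) a t *: F t) ->
  (n <= size s)%N.
Proof.
move=> fe /choice[a ea]; rewrite leqNgt; apply/negP => ltsn.
pose M := \matrix_(i < n, j < size s) a i (tnth (in_tuple s) j).
have /rowV0Pn[b /sub_kermxP bM /eqP bn0] : kermx M != 0.
  rewrite kermx_eq0 /row_free; apply/eqP => rM.
  by have := rank_leq_col M; rewrite rM leqNgt ltsn.
apply: bn0; apply/rowP => i; rewrite mxE; apply: (fe (b 0)).
under eq_bigr do rewrite ea big_tnth scaler_sumr.
rewrite exchange_big big1 // => j _ /=.
under eq_bigr do rewrite scalerA.
rewrite -scaler_suml; have /rowP/(_ j) := bM; rewrite !mxE => bj.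
rewrite (eq_bigr (fun k => b 0 k * M k j)) ?bj ?scale0r // => k _.
by rewrite mxE.
Qed.

Lemma exists_not_span n (e : 'I_n -> V) (T : finType) (F : T -> V)
    (P : pred T) :
  lin_free e -> (#|P| < n)%N -> exists i, ~ span_on F P (e i).
Proof.
move=> fe ltPn; apply: contrapT => h; move: ltPn; rewrite ltnNge cardE.
apply/negP/negPn; apply: (lin_free_span (F := F) fe) => i.
have [a ->] : span_on F P (e i) by apply: contrapT => hi; apply: h; exists i.
by exists a; rewrite big_enum.
Qed.

Lemma exists_free_pair_span n (e : 'I_n -> V) (T : finType) (F : T -> V)
    (P : pred T) : lin_free e -> (#|P|.+1 < n)%N ->
  exists y1 y2, free_pair_mod (span_on F P) y1 y2.
Proof.
move=> fe ltPn; have hA := span_on_submod F P.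
have [i ny1] := exists_not_span F fe (ltnW ltPn); exists (e i).
have Aeq u v : span_on F P u -> u = v -> span_on F P v by move=> Au <-.
have [j nj] : exists j, forall k, ~ span_on F P (e j - k *: e i).
  apply: contrapT => nex; move: ltPn; rewrite ltnNge => /negP; apply.
  (* [None] indexes the extra vector [e i]: otherwise #|P| + 1 vectors would span all of [e]. *)
  rewrite cardE -(size_map Some).
  apply: (lin_free_span (s := None :: map Some (enum P)) (F := oapp F (e i)) fe).
  move=> j; have [k [a ea]] : exists k, span_on F P (e j - k *: e i).
    apply: contrapT => nj; apply: nex; exists j => k hk.
    by apply: nj; exists k.
  exists (oapp a k); rewrite big_cons big_map /= big_enum /= -ea.
  by rewrite addrC subrK.
exists (e j) => a b Aab; have [b0|bn0] := eqVneq b 0.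
  split=> //; apply/eqP; apply: contrapT => /negP an0; apply: ny1.
  move/(submodZ hA a^-1): Aab.
  by rewrite b0 scale0r addr0 scalerA mulVf // scale1r.
case: (nj (- (b^-1 * a))); move/(submodZ hA b^-1): Aab.
by rewrite scalerDr !scalerA mulVf // scale1r scaleNr opprK addrC.
Qed.

Lemma eq_span_on (T : finType) (F F' : T -> V) (P : pred T) :
  (forall t, P t -> F t = F' t) -> span_on F P = span_on F' P.
Proof.
move=> eF; apply/funext => x; apply/propext.
by split=> -[a ->]; exists a; apply: eq_bigr => t Pt; rewrite eF.
Qed.

(** * Greedy choice of the intermediate vectors *)

Section Greedy.
Variables (T : finType) (C : eqType) (cls : T -> C) (N : nat).
Hypothesis card_cls : forall k, (#|[pred t | cls t == k]| <= N)%N.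
Hypothesis dimV : exists n (e : 'I_n -> V), (N <= n)%N /\ lin_free e.

(** [T] consists of slots, and [P] marks those already filled. *)
Definition free_on_classes (F : T -> V) (P : pred T) :=
  forall k, free_on F (fun t => P t && (cls t == k)).

Definition large_rank (f : V -> V) := exists n (e : 'I_n -> V),
  [/\ (N <= n)%N, lin_free e & forall i, range f (e i)].

(** An empty slot in a class leaves fewer than [N] filled ones there, so their span is proper. If
    [t1] and [t2] share a class, a pair independent modulo this span is needed; otherwise two proper
    subspaces are avoided. *)
Lemma greedy_step (F : T -> V) (P : pred T) t1 t2 (g : GL V) :
  t1 != t2 -> ~~ P t1 -> ~~ P t2 ->
  (cls t1 = cls t2 -> forall a, a != 0 -> large_rank (fun x => g x - a *: x)) ->
  free_on_classes F P ->
  exists F', [/\ forall t, P t -> F' t = F t, F' t2 = g (F' t1) &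
    free_on_classes F' (fun t => [|| t == t1, t == t2 | P t])].
Proof.
move=> n12 nP1 nP2 hg hF; pose Pk k := fun t => P t && (cls t == k).
have [n [e [leNn fe]]] := dimV.
have surj x : exists y, g y = x by have [f _ fK] := gl_bij g; exists (f x).
have gl := gl_linear g.
have subm k : is_submod (span_on F (Pk k)) by exact: span_on_submod.
have ltPk t : ~~ P t -> (#|Pk (cls t)| < N)%N.
  move=> nPt; apply: leq_trans (card_cls (cls t)); apply: fintype.proper_card.
  apply/fintype.properP; split; first by apply/fintype.subsetP => s /andP[].
  by exists t; rewrite unfold_in /= ?eqxx // /Pk (negbTE nPt).
pose upd y t := if t == t1 then y else if t == t2 then g y else F t.
have upd1 y : upd y t1 = y by rewrite /upd eqxx.
have upd2 y : upd y t2 = g y by rewrite /upd eq_sym (negbTE n12) eqxx.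
have updF y t : P t -> F t = upd y t.
  rewrite /upd; case: eqP => [->|_]; first by rewrite (negbTE nP1).
  by case: eqP => [->|//]; rewrite (negbTE nP2).
have updPk y k t : Pk k t -> F t = upd y t by move=> /andP[/updF].
suff [y hy] : exists y,
    free_on_classes (upd y) (fun t => [|| t == t1, t == t2 | P t]).
  by exists (upd y); split=> // [t Pt|]; [rewrite -updF|rewrite upd1 upd2].
have freePk y k : free_on (upd y) (Pk k).
  by apply: eq_free_on (hF k) => // t; exact: updPk.
have [e12|n12'] := eqVneq (cls t1) (cls t2).
  (* Both new slots belong to this class, so at most [N - 2] of its slots are filled. *)
  have lt2 : (#|Pk (cls t1)|.+1 < n)%N.
    apply: leq_trans leNn; apply: leq_trans (card_cls (cls t1)).
    pose Q := [pred t | cls t == cls t1]; rewrite -/Q.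
    rewrite (cardD1 t1 Q) (cardD1 t2 [predD1 Q & t1]) !inE.
    rewrite eq_sym n12 -e12 !eqxx.
    rewrite !add1n !ltnS; apply: subset_leq_card.
    apply/fintype.subsetP => t /andP[Pt ct].
    rewrite !inE ct !andbT; apply/andP; split; apply/eqP => et; subst t.
      by rewrite Pt in nP2.
    by rewrite Pt in nP1.
  have [||y hy] := exists_free_pair_mod (subm (cls t1)) gl.
  - exact: exists_free_pair_span fe lt2.
  (* The scalar 0 is not covered by [hg]; there [g] itself is onto. *)
  - move=> a; have [->|/hg] := eqVneq a 0.
      have [i hi] := exists_not_span F fe (ltnW lt2).
      by have [y ey] := surj (e i); exists y; rewrite ey scale0r subr0.
    case=> // n' [e' [leNn' fe' re']].
    have [i hi] := exists_not_span F fe' (leq_trans (ltPk _ nP1) leNn').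
    by have [y _ ey] := re' i; exists y; rewrite ey.
  exists y => k; have [ek|nk] := eqVneq (cls t1) k; last first.
    apply: (eq_free_on (P := Pk k) (F := upd y)) => // t; rewrite /Pk.
    case: (t =P t1) => [->|_]; first by rewrite (negbTE nk) !andbF.
    by case: (t =P t2) => [->|_ //]; rewrite -e12 (negbTE nk) !andbF.
  subst k; apply: (@eq_free_on _ (upd y) _
    (fun s => (s == t1) || ((s == t2) || Pk (cls t1) s))) => //.
    move=> t /=; rewrite /Pk; case: (t =P t1) => [->|_] /=; first by rewrite eqxx.
    by case: (t =P t2) => [->|_ //]; rewrite -e12 eqxx.
  apply: free_on_add; first by rewrite negb_or n12 /Pk negb_and nP1.
    rewrite upd1 => -[a]; rewrite sum_predU1; last by rewrite /Pk negb_and nP2.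
    rewrite upd2 => ey.
    have [|/eqP] := hy 1 (- a t2); last by rewrite oner_eq0.
    rewrite (eq_span_on (updPk y _)); exists a.
    by rewrite scale1r scaleNr {1}ey addrAC subrr add0r.
  apply: free_on_add => //; first by rewrite /Pk negb_and nP2.
  rewrite upd2 -(eq_span_on (updPk y _)) => hgy.
  have [|_ /eqP] := hy 0 1; last by rewrite oner_eq0.
  by rewrite scale0r add0r scale1r.
have [||||y [hy1 hy2]] := @avoid_two_submods (span_on F (Pk (cls t1)))
  (fun y => span_on F (Pk (cls t2)) (g y)).
- exact: subm.
- split; last by move=> a x y gx gy; rewrite gl; apply: (subm _).2.
  have := gl (-1) 0 0; rewrite scaler0 add0r scaleN1r addNr => ->.
  exact: (subm _).1.
- by have [i hi] := exists_not_span F fe (leq_trans (ltPk _ nP1) leNn); exists (e i).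
- have [i hi] := exists_not_span F fe (leq_trans (ltPk _ nP2) leNn).
  by have [y ey] := surj (e i); exists y; rewrite ey.
exists y => k; have [e1|nk1] := eqVneq (cls t1) k.
  subst k; apply: (@eq_free_on _ (upd y) _
    (fun s => (s == t1) || Pk (cls t1) s)) => //.
    move=> t /=; rewrite /Pk; case: (t =P t1) => [->|_] /=; first by rewrite eqxx.
    by case: (t =P t2) => [->|_ //]; rewrite eq_sym (negbTE n12') !andbF.
  apply: free_on_add => //; first by rewrite /Pk negb_and nP1.
  by rewrite upd1 -(eq_span_on (updPk y _)).
have [e2|nk2] := eqVneq (cls t2) k.
  subst k; apply: (@eq_free_on _ (upd y) _
    (fun s => (s == t2) || Pk (cls t2) s)) => //.
    move=> t /=; rewrite /Pk; case: (t =P t1) => [->|_] /=; last first.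
      by case: (t =P t2) => [->|_ //]; rewrite eqxx.
    by rewrite (negbTE n12) (negbTE n12') andbF.
  apply: free_on_add => //; first by rewrite /Pk negb_and nP2.
  by rewrite upd2 -(eq_span_on (updPk y _)).
apply: (eq_free_on (P := Pk k) (F := upd y)) => // t; rewrite /Pk.
case: (t =P t1) => [->|_]; first by rewrite (negbTE nk1) !andbF.
by case: (t =P t2) => [->|_ //]; rewrite (negbTE nk2) !andbF.
Qed.

(** The slots [t1 i], [t2 i] are pairwise distinct and outside [P], so both are still empty when [i]
    is reached. *)
Lemma greedy_fill (I : eqType) (s : seq I) (t1 t2 : I -> T) (g : I -> GL V)
    (F : T -> V) (P : pred T) :
  uniq s -> injective t1 -> injective t2 -> (forall i j, t1 i != t2 j) ->
  (forall i, ~~ P (t1 i)) -> (forall i, ~~ P (t2 i)) ->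
  (forall i, cls (t1 i) = cls (t2 i) ->
     forall a, a != 0 -> large_rank (fun x => g i x - a *: x)) ->
  free_on_classes F P ->
  exists F', [/\ forall t, P t -> F' t = F t,
    forall i, i \in s -> F' (t2 i) = g i (F' (t1 i)) &
    free_on_classes F'
      (fun t => P t || has (fun i => (t == t1 i) || (t == t2 i)) s)].
Proof.
move=> us inj1 inj2 n12 nP1 nP2 hg hF.
elim: s us => [_|i s IH /=/andP[nis /IH[F1 [F1P F1g F1f]]]].
  exists F; split=> // k; apply: eq_free_on (hF k) => // t.
  by rewrite /= orbF.
set P1 := (fun t => _) in F1f.
have nt t : has (fun j => (t1 t == t1 j) || (t1 t == t2 j)) s = (t \in s).
  apply/hasP/idP => [[j js]|ts]; last by exists t; rewrite // eqxx.
  by rewrite (negbTE (n12 _ _)) orbF => /eqP/inj1 ->.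
have nt' t : has (fun j => (t2 t == t1 j) || (t2 t == t2 j)) s = (t \in s).
  apply/hasP/idP => [[j js]|ts]; last by exists t; rewrite // eqxx orbT.
  by rewrite eq_sym (negbTE (n12 _ _)) => /eqP/inj2 ->.
have [||||F2 [F2P F2g F2f]] := @greedy_step F1 P1 (t1 i) (t2 i) (g i) (n12 i i).
- by rewrite /P1 nt (negbTE (nP1 _)).
- by rewrite /P1 nt' (negbTE (nP2 _)).
- exact: hg.
- exact: F1f.
exists F2; split=> [t Pt|j|k].
- by rewrite F2P ?F1P // /P1 Pt.
- rewrite inE => /predU1P[->//|js].
  by rewrite !F2P ?F1g // /P1 ?nt ?nt' js orbT.
- apply: eq_free_on (F2f k) => // t; congr (_ && _); rewrite /P1.
  by do !case: (_ == _); case: (P t).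
Qed.

End Greedy.

(** * Reindexing and completing families; transitivity for prescribed families *)

Lemma free_on_comp (S T : finType) (f : S -> T) (F : T -> V) (P : pred S)
    (Q : pred T) : {in P &, injective f} -> (forall s, P s -> Q (f s)) ->
  free_on F Q -> free_on (F \o f) P.
Proof.
move=> finj PQ fF a a0 s Ps.
(* Coefficients are pushed forward along [f]; each fibre in [P] has at most one point. *)
have := fF (fun t => \sum_(s | P s && (f s == t)) a s).
have -> : \sum_(t | Q t) (\sum_(s | P s && (f s == t)) a s) *: F t = 0.
  rewrite -[RHS]a0 (partition_big f Q) //=; apply: eq_bigr => t _.
  by rewrite scaler_suml; apply: eq_bigr => s' /andP[_ /eqP ->].
move=> /(_ erefl _ (PQ s Ps)) <-; rewrite (bigD1 s) ?Ps ?eqxx //= big1 ?addr0 //.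
by move=> s' /andP[/andP[Ps' /eqP/finj ->]]; rewrite ?eqxx.
Qed.

(** Empty places receive, one at a time, some [e i] outside the current span. This serves to reach
    exactly [D] vectors, as transitivity demands. *)
Lemma free_on_extend (T : finType) (P : pred T) (F : T -> V) n
    (e : 'I_n -> V) : lin_free e -> (#|T| <= n)%N -> free_on F P ->
  exists F', (forall t, P t -> F' t = F t) /\ free_on F' predT.
Proof.
move=> fe leTn; move: {2}(#|predC P|) (leqnn #|predC P|) => m.
elim: m P F => [|m IH] P F lem fF.
  exists F; split=> //; apply: eq_free_on fF => // t.
  move: lem; rewrite leqn0 => /eqP/card0_eq/(_ t).
  by rewrite inE => /negbFE.
have [[t nPt]|nex] := pselect (exists t, ~~ P t); last first.
  exists F; split=> //; apply: eq_free_on fF => // t.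
  by apply/negP => nPt; apply: nex; exists t; apply/negP.
have ltP : (#|P| < n)%N.
  apply: leq_trans leTn; rewrite -(cardC P) -[X in (X < _)%N]addn0 ltn_add2l.
  by rewrite (cardD1 t) !inE nPt.
have [i hi] := exists_not_span F fe ltP.
pose F1 s := if s == t then e i else F s.
have F1P s : P s -> F s = F1 s.
  by rewrite /F1; case: eqP => // ->; rewrite (negbTE nPt).
have [||F' [F'F F'f]] := IH (fun s => (s == t) || P s) F1.
- move: lem; rewrite (cardD1 t) !inE nPt add1n ltnS; apply: leq_trans.
  by rewrite subset_leq_card //; apply/fintype.subsetP => s; rewrite !inE negb_or.
- apply: free_on_add => //.
    by rewrite {2}/F1 eqxx -(eq_span_on F1P).
  exact: eq_free_on fF.
exists F'; split=> // s Ps; rewrite F'F ?Ps ?orbT //.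
by rewrite -F1P.
Qed.

Lemma edim_lin_free (R : realType) (W : set V) n : (n%:R%:E <= edim R W)%E ->
  exists m (e : 'I_m -> V), [/\ (n <= m)%N, lin_free e & forall i, W (e i)].
Proof.
case: n => [_|n hn]; first by exists 0%N, (fun=> 0); split=> // [a _|] [].
(* The supremum need not be attained, but some dimension exceeds [n] strictly. *)
have /ereal_sup_gt[_ [m [e [fe We]] <-]] : (n%:R%:E < edim R W)%E.
  by apply: lt_le_trans hn; rewrite lte_fin ltr_nat.
by rewrite lte_fin ltr_nat => ltnm; exists m, e.
Qed.

(** Both families are listed in the first places of ['I_D] and completed to [D] independent
    vectors. *)
Lemma lin_transitive_free_on (R : realType) D (H : groupClosed (GL V))
    (T : finType) (P : pred T) (F F' : T -> V) :
  lin_transitive R D H -> (#|P| <= D)%N -> free_on F P -> free_on F' P ->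
  exists2 h : GL V, h \in H & forall t, P t -> h (F t) = F' t.
Proof.
move=> [/edim_lin_free[n [e [leDn fe _]]] tr] leP fF fF'.
have [[t0 Pt0]|nP] := pselect (exists t, P t); last first.
  exists 1%g; first exact: gpred1.
  by move=> t Pt; case: nP; exists t.
pose f (i : 'I_D) := nth t0 (enum P) i.
have leTn : (#|'I_D| <= n)%N by rewrite card_ord.
have ext G : free_on G P -> exists G' : 'I_D -> V,
    (forall i : 'I_D, (i < #|P|)%N -> G' i = G (f i)) /\ lin_free G'.
  move=> fG; have [|G' [G'G fG']] := free_on_extend
      (P := fun i : 'I_D => (i < #|P|)%N) (F := G \o f) fe leTn.
    apply: free_on_comp fG.
      move=> i j iP jP /eqP; rewrite nth_uniq ?enum_uniq -?cardE //.
      by move=> /eqP/val_inj.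
    move=> i iP; have := mem_nth t0 (s := enum P).
    by rewrite -cardE => /(_ _ iP); rewrite mem_enum.
  by exists G'; split=> // a a0 i; apply: fG'.
have [G [GF fG]] := ext _ fF; have [G' [GF' fG']] := ext _ fF'.
have [h hH hG] := tr _ _ fG fG'; exists h => // t Pt.
have ltt : (index t (enum P) < #|P|)%N by rewrite cardE index_mem mem_enum.
pose i := Ordinal (leq_trans ltt leP).
have ft : f i = t by rewrite /f nth_index // mem_enum.
by rewrite -ft -GF // -GF'.
Qed.

(** The flags tell which ends of the trajectories fall into a given class; trivial intersection
    matters only if both do. *)
Lemma free_on_sum d (u v : 'I_d -> V) (b1 b2 : bool) :
  lin_free u -> lin_free v ->
  (b1 -> b2 -> lin_span u `&` lin_span v = [set 0]) ->
  free_on (fun s : 'I_d + 'I_d => match s with inl i => u i | inr i => v i end)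
    (fun s => match s with inl _ => b1 | inr _ => b2 end).
Proof.
move=> fu fv huv a; rewrite big_sumType /=.
case: b1 b2 huv => [] [] //= huv.
- set x := (X in X + _ = 0); set y := (X in _ + X = 0) => a0.
  have x0 : x = 0.
    have : (lin_span u `&` lin_span v) x; last by rewrite huv.
    split; first by exists (fun i => a (inl i)).
    exists (fun i => - a (inr i)).
    move/eqP: a0; rewrite addr_eq0 => /eqP ->; rewrite -sumrN.
    by apply: eq_bigr => i _; rewrite scaleNr.
  move: a0; rewrite x0 add0r => y0 [i _|i _].
    exact: (fu (fun i => a (inl i))).
  exact: (fv (fun i => a (inr i))).
- rewrite [X in _ + X]big_pred0 // addr0 => a0 [i _|//].
  exact: (fu (fun i => a (inl i))).
- rewrite big_pred0 // add0r => a0 [//|i _]; exact: (fv (fun i => a (inr i))).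
- by move=> _ [].
Qed.
End LinearAlgebra.

(** * Consequences of the bound on [d] *)

Section CriticalLength.
Variables (R : realType) (K : fieldType) (V : lmodType K).

Lemma crit_length_bounds (D d l r : nat) (iota : nat -> 'I_r)
    (eps : nat -> bool) (c : nat -> GL V) : (0 < l)%N ->
  (d%:R%:E <= (l%:R^-1)%:E *
     Order.min (crit_length R l iota eps c - 1) D%:R%:E)%E ->
  (l * d <= D)%N /\
  forall j, J_minus l iota eps j -> forall a, a != 0 ->
    large_rank (l * d) (fun x => c j x - a *: x).
Proof.
move=> l0; rewrite lee_pdivlMl ?ltr0n // -EFinM -natrM le_min => /andP[hc].
rewrite lee_fin ler_nat => leD; split=> // j Jj a a0.
apply: (@edim_lin_free _ _ R); apply: le_trans (_ : (_ <= proj_rank R (c j))%E) _.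
  apply: le_trans (_ : (_ <= crit_length R l iota eps c)%E) _.
    apply: le_trans hc _; rewrite leeBlDr //.
    by rewrite leeDl // lee_fin.
  by apply: ereal_inf_lbound; right; exists j.
by apply: ereal_inf_lbound; exists a.
Qed.

End CriticalLength.

(** * Evaluating the word along a trajectory *)

Section Evaluation.
Variables (G : groupType) (r : nat) (h : 'I_r -> G).
Variables (iota : nat -> 'I_r) (eps : nat -> bool).

Lemma eval_syllable j : freeprod_eval h (syllable G iota eps j) =
  if eps j then ((h (iota j))^-1)%g else h (iota j).
Proof.
rewrite /syllable; case: (eps j); last exact: freeprod_eval_var.
by rewrite freeprod_varV freeprod_eval_pi /word_eval big_seq1.
Qed.

Lemma eval_one : freeprod_eval h (1%g : freeprod G r) = 1%g.
Proof.
by rewrite -[1%g]/(fone G r) freeprod_eval_pi /word_eval big_nil.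
Qed.

End Evaluation.

(** [x j] and [y j] are the positions of one trajectory before and after letter [j]. *)
Lemma eval_word_expr (K : fieldType) (V : lmodType K) (r : nat)
    (h : 'I_r -> GL V) (iota : nat -> 'I_r) (eps : nat -> bool)
    (c : nat -> GL V) (x y : nat -> V) n :
  (forall j, (0 < j <= n.+1)%N ->
     (freeprod_eval h (syllable (GL V) iota eps j) : GL V) (x j) = y j) ->
  (forall j, (0 < j <= n)%N -> c j (y j) = x j.+1) ->
  (freeprod_eval h (word_expr n.+1 iota eps c) : GL V) (x 1%N) = y n.+1.
Proof.
move=> hs hc; rewrite /word_expr freeprod_evalM /=.
rewrite -[RHS]hs ?leqnn //; congr ((freeprod_eval h (syllable _ _ _ _) : GL V) _).
(* The prefix of [m] letters with their coefficients carries [x 1] to [x m.+1]. *)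
elim: {-2}n (leqnn n) => [|m IH] lemn.
  by rewrite big_geq // eval_one.
rewrite big_nat_recr //= freeprod_evalM freeprod_evalM freeprod_eval_in /=.
rewrite IH ?(ltnW lemn) //.
have -> := hs m.+1 (leqW lemn).
exact: hc m.+1 lemn.
Qed.

(** * Filling all slots and choosing the [h k] *)

Theorem theorem1 (R : realType) (K : fieldType) (V : lmodType K)
    (hKV : (finite_set [set: K] /\ countable_dim V) \/
           ((exists f : {rmorphism K -> R[i]}, bijective f) /\ finite_dim V))
    (D d l r : nat) (hl : (2 <= l)%N)
    (H : groupClosed (GL V)) (hH : lin_transitive R D H)
    (iota : nat -> 'I_r) (eps : nat -> bool) (c : nat -> GL V)
    (w : freeprod (GL V) r) (hw : w = word_expr l iota eps c)
    (hred : reduced l iota eps c H)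
    (u v : 'I_d -> V) (hu : lin_free u) (hv : lin_free v)
    (huv : iota 1%N = iota l -> eps 1%N <> eps l ->
           lin_span u `&` lin_span v = [set 0])
    (hd : (d%:R%:E <= (l%:R^-1)%:E *
             Order.min (crit_length R l iota eps c - 1) D%:R%:E)%E) :
  exists h : 'I_r -> GL V,
    (forall i, h i \in H) /\
    (forall i, (freeprod_eval h w : GL V) (u i) = v i).
Proof.
case: l hl hw hred huv hd => // n _ hw _ huv /crit_length_bounds[] // leD hrank.
(* (j, i, b) stands for the vector of the i-th trajectory before (b = false)
   or after (b = true) letter j.+1; cls sends it to (k, false) if it is a
   prescribed argument of h_k, and to (k, true) if it is a prescribed value. *)
pose slot : finType := ('I_n.+1 * 'I_d * bool)%type.
pose cls (t : slot) : 'I_r * bool :=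
  let: (j, i, b) := t in (iota j.+1, b (+) eps j.+1).
have card_cls k : (#|[pred t | cls t == k]| <= n.+1 * d)%N.
  have -> : (n.+1 * d)%N = #|{: 'I_n.+1 * 'I_d}| by rewrite card_prod !card_ord.
  (* Within a class, [(j, i)] determines [b]. *)
  apply: (@leq_card_in _ _ (fun t : slot => t.1)) => -[[j i] b] [[j' i'] b'].
  rewrite !inE => /eqP <- /eqP[_ e] [ej ei]; subst j' i'.
  by move/addIb: e => ->.
have dimV : exists m (e : 'I_m -> V), (n.+1 * d <= m)%N /\ lin_free e.
  have [m [e [leDm fe _]]] := edim_lin_free hH.1.
  by exists m, e; split=> //; apply: leq_trans leDm.
(* Filled at first: [u i] before the first letter and [v i] after the last. *)
pose F0 (t : slot) := let: (j, i, b) := t in if b then v i else u i.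
pose P0 (t : slot) := let: (j, i, b) := t in j == if b then ord_max else ord0.
have F0free : free_on_classes cls F0 P0.
  move=> k; pose side (t : slot) : 'I_d + 'I_d :=
    if t.2 then inr t.1.2 else inl t.1.2.
  pose b1 := (iota 1%N, eps 1%N) == k; pose b2 := (iota n.+1, ~~ eps n.+1) == k.
  (* Both ends share a class only if the outer letters are mutually inverse, the case covered by
     [huv]. *)
  have disj : b1 -> b2 -> lin_span u `&` lin_span v = [set 0].
    move=> /eqP e1 /eqP; rewrite -e1 => -[ei ee]; apply: huv; rewrite ?ei // -ee.
    by case: (eps n.+1).
  apply: eq_free_on (free_on_comp (f := side)
    (P := fun t => P0 t && (cls t == k)) _ _ (free_on_sum hu hv disj)) => //.
  - by move=> [[j i] []].
  - move=> [[j i] b] [[j' i'] b'] /andP[/= /eqP ej _] /andP[/= /eqP ej' _].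
    by rewrite /side /=; case: b b' ej ej' => [] [] -> -> //= [->].
  - move=> [[j i] b] /andP[/= /eqP -> /eqP ek]; rewrite /side /b1 /b2 -ek.
    by case: b {ek}; rewrite /= ?addTb ?addFb eqxx.
(* [t1 m] and [t2 m] lie just before and just after the coefficient [c m.1.+1]. *)
pose t1 (m : 'I_n * 'I_d) : slot := (widen_ord (leqnSn n) m.1, m.2, true).
pose t2 (m : 'I_n * 'I_d) : slot := (lift ord0 m.1, m.2, false).
have [|||||||F [FP0 Fg Ff]] := @greedy_fill _ _ _ _ cls _ card_cls dimV _
  (enum {: 'I_n * 'I_d}) t1 t2 (fun m => c m.1.+1) F0 P0 (enum_uniq _).
- by move=> [j i] [j' i'] [/val_inj -> ->].
- by move=> [j i] [j' i'] [/val_inj -> ->].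
- by move=> i j; apply/eqP.
- move=> [j i]; rewrite /P0 /=; apply/eqP => /(congr1 val) /= jn.
  by have := ltn_ord j; rewrite jn ltnn.
- by move=> [j i].
(* The slots around a coefficient share a class exactly when its index is in [J_minus]. *)
- move=> [j i] /= [ei ee] a a0; apply: hrank => //; split=> //=.
    by rewrite ltnS ltn_ord.
  by move=> ee'; move: ee; rewrite /= /bump add1n -ee'; case: (eps _).
- exact: F0free.
have {}Ff k : free_on F (fun t => cls t == k).
  apply: eq_free_on (Ff k) => // -[[j i] b]; rewrite [X in X && _](_ : _ = true) //.
  rewrite /P0; case: b.
    have [//|jn /=] := eqVneq j ord_max.
    have ltjn : (j < n)%N by rewrite ltn_neqAle jn -ltnS ltn_ord.
    apply/hasP; exists (Ordinal ltjn, i); rewrite ?mem_enum //.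
    by apply/orP; left; apply/eqP; congr (_, _, _); apply: val_inj.
  have [j' ->|->] := unliftP ord0 j; last by rewrite eqxx.
  apply/orP; right; apply/hasP; exists (j', i); rewrite ?mem_enum //.
  by rewrite eqxx orbT.
(* The argument of [h k] is the vector before the letter for exponent 1, and the one after it for
   exponent -1. *)
have /choice[h hh] k : exists g : GL V, g \in H /\
    forall x : 'I_n.+1 * 'I_d, iota x.1.+1 == k ->
    g (F (x, eps x.1.+1)) = F (x, ~~ eps x.1.+1).
  have side_free b : free_on (F \o (fun x : 'I_n.+1 * 'I_d => (x, b (+) eps x.1.+1)))
      (fun x => iota x.1.+1 == k).
    apply: free_on_comp (Ff (k, b)); first by move=> x y _ _ [].
    by move=> [j i] /eqP /= <-; rewrite addbK.
  have [|g gH hg] := lin_transitive_free_on hH _ (side_free false) (side_free true).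
    apply: leq_trans leD; rewrite -[X in (_ <= X * _)%N]card_ord.
    by rewrite -[X in (_ <= _ * X)%N]card_ord -card_prod max_card.
  by exists g; split=> // x xk; have := hg x xk; rewrite /= addFb addTb.
exists h; split=> [k|i]; first by have [] := hh k.
(* Letters are numbered from 1, slots from 0. *)
pose x j := F (inord j.-1, i, false); pose y j := F (inord j.-1, i, true).
have -> : u i = x 1%N.
  by rewrite /x FP0 //= /P0; apply/eqP/val_inj; rewrite /= inordK.
have -> : v i = y n.+1.
  by rewrite /y FP0 //= /P0; apply/eqP/val_inj; rewrite /= inordK.
rewrite hw; apply: eval_word_expr => [[//|j] /= ltj|[//|j] /= ltj].
  rewrite eval_syllable; have [_ /(_ (inord j, i))] := hh (iota j.+1).
  rewrite /= inordK // eqxx /x /y /= => /(_ isT).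
  case: (eps j.+1) => //= <-; exact: (gl_invP _).1.
rewrite /x /y /=.
have := Fg (Ordinal ltj, i); rewrite mem_enum => /(_ isT).
rewrite /t1 /t2 /= => e; have -> : inord j.+1 = lift ord0 (Ordinal ltj).
  by apply: val_inj; rewrite /= inordK.
rewrite e; congr (c _ (F (_, _, _))); apply: val_inj.
by rewrite /= inordK // ltnW.
Qed.
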